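(* Let $G^\sigma$ be a $4$-regular oriented graph with optimum skew energy. Then the underlying graph $G$ belongs to $\mathcal{F}$, i.e. $G$ is isomorphic to one of: $G_1$, $G_2$, $G_3$, the hypercube $Q_4$, $\mathcal{G}_i$ for some positive integer $i$, or $\mathcal{H}_j$ for some positive integer $j$.
   Context: For a simple undirected graph $G$ on $n$ vertices $v_1,\dots,v_n$, an orientation $\sigma$ yields an oriented graph $G^\sigma$ with skew-adjacency matrix $S(G^\sigma)=[s_{ij}]$, where $s_{ij}=1$, $s_{ji}=-1$ if $\langle v_i,v_j\rangle$ is an arc and $s_{ij}=s_{ji}=0$ otherwise. The skew energy $\mathcal{E}_S(G^\sigma)$ is the sum of the absolute values of the eigenvalues of $S(G^\sigma)$; $G^\sigma$ has optimum skew energy if $\mathcal{E}_S(G^\sigma)=n\sqrt{\Delta}$, $\Delta$ the maximum degree (equivalently $S(G^\sigma)^TS(G^\sigma)=\Delta I_n$). $G_1$: vertices $u_1,\dots,u_4,v_1,\dots,v_4$; $\{u_1,\dots,u_4\}$ and $\{v_1,\dots,v_4\}$ each induce $K_4$, plus edges $u_iv_i$ ($i=1,\dots,4$); i.e. $K_4\square K_2$. $G_2$: the octahedron $K_{2,2,2}$ on $6$ vertices. $G_3$: vertices $u,v,u_1,\dots,u_6,v_1,\dots,v_5,w$ with edges $uu_1,uu_2,uv_1,uv_2,vu_1,vu_2,vu_5,vu_6,u_1u_3,u_1u_4,u_2v_3,u_2v_4,v_1u_3,v_1v_3,v_1w,v_2u_4,v_2v_4,v_2w,u_3u_5,u_3v_5,u_4u_6,u_4v_5,v_3u_6,v_3v_5,v_4u_5,v_4v_5,wu_5,wu_6$.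 $\mathcal{G}_i$ ($i\ge1$): vertices $u,v,u_1,\dots,u_{2i+2},v_1,\dots,v_{2i+2}$; $u,v$ each adjacent to $u_1,u_2,v_1,v_2$; for $k=1,\dots,i$, each of $u_{2k-1},u_{2k}$ adjacent to each of $u_{2k+1},u_{2k+2}$ and each of $v_{2k-1},v_{2k}$ adjacent to each of $v_{2k+1},v_{2k+2}$; plus edges $u_{2i+1}v_{2i+2},v_{2i+2}u_{2i+2},u_{2i+2}v_{2i+1},v_{2i+1}u_{2i+1}$. $\mathcal{H}_j$ ($j\ge1$): vertices $u,v,u_1,\dots,u_{2j+2},v_1,\dots,v_{2j}$; $u,v$ each adjacent to $u_1,u_2,v_1,v_2$; for $k=1,\dots,j$, each of $u_{2k-1},u_{2k}$ adjacent to each of $u_{2k+1},u_{2k+2}$; for $k=1,\dots,j-1$, each of $v_{2k-1},v_{2k}$ adjacent to each of $v_{2k+1},v_{2k+2}$; each of $v_{2j-1},v_{2j}$ adjacent to each of $u_{2j+1},u_{2j+2}$.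
   Formalization: G is additionally assumed connected and nonempty; without this the claim fails, e.g. for two disjoint copies of an octahedron with optimum skew energy, since every graph in F is connected. *)

(* Defs.v *)
From HB Require Import structures.
From mathcomp Require Import all_boot all_order all_algebra.
Set Implicit Arguments.
Unset Strict Implicit.
Unset Printing Implicit Defensive.
Import GRing.Theory Num.Theory.
Local Open Scope ring_scope.

Definition simple_graph (T : finType) (e : rel T) : Prop :=
  symmetric e /\ irreflexive e.

Definition degree (T : finType) (e : rel T) (x : T) : nat := #|[set y | e x y]|.

Definition max_degree (T : finType) (e : rel T) : nat := \max_(x : T) degree e x.

Definition regular (d : nat) (T : finType) (e : rel T) : Prop :=
  forall x, degree e x = d.

(* The graph without vertices is not connected. *)
Definition connected (T : finType) (e : rel T) : Prop :=
  (0 < #|T|)%N /\ forall x y, connect e x y.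

Definition isomorphic (T T' : finType) (e : rel T) (e' : rel T') : Prop :=
  exists2 f : T -> T', bijective f & forall x y, e x y = e' (f x) (f y).

(* [o x y] means that <x, y> is an arc. *)
Definition orientation (T : finType) (e o : rel T) : Prop :=
  forall x y, (e x y = o x y || o y x) /\ ~~ (o x y && o y x).

Definition skew_adjacency (C : numClosedFieldType) (n : nat) (o : rel 'I_n)
    : 'M[C]_n :=
  \matrix_(i, j) (if o i j then 1 else if o j i then -1 else 0).

(* The eigenvalues, listed with algebraic multiplicity: the char_poly is the
   product of the 'X - z%:P over this list. *)
Definition eigenvalues (C : numClosedFieldType) (n : nat) (A : 'M[C]_n) : seq C :=
  sval (closed_field_poly_normal (char_poly A)).

Definition skew_energy (C : numClosedFieldType) (n : nat) (o : rel 'I_n) : C :=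
  \sum_(z <- eigenvalues (skew_adjacency C o)) `|z|.

Definition optimum_skew_energy (C : numClosedFieldType) (n : nat)
    (e o : rel 'I_n) : Prop :=
  skew_energy C o = n%:R * sqrtC (max_degree e)%:R.

Local Open Scope nat_scope.

(* [U k] and [V k] are the vertices u_k and v_k, with k >= 1;
   [U0], [V0], [W0] are the unindexed vertices u, v, w. *)
Inductive vname : Type := U0 | V0 | W0 | U of nat | V of nat.

Definition vname_code (x : vname) : nat * nat :=
  match x with
  | U0 => (0, 0) | V0 => (1, 0) | W0 => (2, 0) | U k => (3, k) | V k => (4, k)
  end.

Definition vname_decode (c : nat * nat) : vname :=
  match c.1 with
  | 0 => U0 | 1 => V0 | 2 => W0 | 3 => U c.2 | _ => V c.2
  end.

Lemma vname_codeK : cancel vname_code vname_decode.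
Proof. by case. Qed.

HB.instance Definition _ := Countable.copy vname (can_type vname_codeK).

Definition list_graph (vs : seq vname) (es : seq (vname * vname))
    : rel (seq_sub vs) :=
  fun x y => ((val x, val y) \in es) || ((val y, val x) \in es).

Definition join (A B : seq vname) : seq (vname * vname) :=
  [seq (a, b) | a <- A, b <- B].

(* {u_{2k-1}, u_{2k}} and {v_{2k-1}, v_{2k}}, for k >= 1 *)
Definition U2 (k : nat) : seq vname := [:: U (2 * k - 1); U (2 * k)].
Definition V2 (k : nat) : seq vname := [:: V (2 * k - 1); V (2 * k)].

Definition G1_vertices : seq vname :=
  [seq U i | i <- iota 1 4] ++ [seq V i | i <- iota 1 4].
Definition G1_edges : seq (vname * vname) :=
  [:: (U 1, U 2); (U 1, U 3); (U 1, U 4); (U 2, U 3); (U 2, U 4); (U 3, U 4);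
      (V 1, V 2); (V 1, V 3); (V 1, V 4); (V 2, V 3); (V 2, V 4); (V 3, V 4);
      (U 1, V 1); (U 2, V 2); (U 3, V 3); (U 4, V 4)].
Definition G1 := list_graph (vs := G1_vertices) G1_edges.

(* K_{2,2,2}: the three parts are the fibres of the first projection. *)
Definition G2 : rel ('I_3 * bool) := fun x y => x.1 != y.1.

Definition G3_vertices : seq vname :=
  [:: U0; V0; W0] ++ [seq U i | i <- iota 1 6] ++ [seq V i | i <- iota 1 5].
Definition G3_edges : seq (vname * vname) :=
  [:: (U0, U 1); (U0, U 2); (U0, V 1); (U0, V 2);
      (V0, U 1); (V0, U 2); (V0, U 5); (V0, U 6);
      (U 1, U 3); (U 1, U 4); (U 2, V 3); (U 2, V 4);
      (V 1, U 3); (V 1, V 3); (V 1, W0);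
      (V 2, U 4); (V 2, V 4); (V 2, W0);
      (U 3, U 5); (U 3, V 5); (U 4, U 6); (U 4, V 5);
      (V 3, U 6); (V 3, V 5); (V 4, U 5); (V 4, V 5);
      (W0, U 5); (W0, U 6)].
Definition G3 := list_graph (vs := G3_vertices) G3_edges.

Definition hypercube (d : nat) : rel {ffun 'I_d -> bool} :=
  fun x y => #|[set i | x i != y i]| == 1.

Definition calG_vertices (i : nat) : seq vname :=
  [:: U0; V0] ++ [seq U k | k <- iota 1 (2 * i + 2)]
              ++ [seq V k | k <- iota 1 (2 * i + 2)].
Definition calG_edges (i : nat) : seq (vname * vname) :=
  join [:: U0; V0] [:: U 1; U 2; V 1; V 2]
  ++ flatten [seq join (U2 k) (U2 k.+1) ++ join (V2 k) (V2 k.+1) | k <- iota 1 i]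
  ++ [:: (U (2 * i + 1), V (2 * i + 2)); (V (2 * i + 2), U (2 * i + 2));
         (U (2 * i + 2), V (2 * i + 1)); (V (2 * i + 1), U (2 * i + 1))].
Definition calG (i : nat) := list_graph (vs := calG_vertices i) (calG_edges i).

Definition calH_vertices (j : nat) : seq vname :=
  [:: U0; V0] ++ [seq U k | k <- iota 1 (2 * j + 2)]
              ++ [seq V k | k <- iota 1 (2 * j)].
Definition calH_edges (j : nat) : seq (vname * vname) :=
  join [:: U0; V0] [:: U 1; U 2; V 1; V 2]
  ++ flatten [seq join (U2 k) (U2 k.+1) | k <- iota 1 j]
  ++ flatten [seq join (V2 k) (V2 k.+1) | k <- iota 1 (j - 1)]
  ++ join (V2 j) (U2 j.+1).
Definition calH (j : nat) := list_graph (vs := calH_vertices j) (calH_edges j).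

Definition in_F (T : finType) (e : rel T) : Prop :=
  isomorphic e G1 \/ isomorphic e G2 \/ isomorphic e G3 \/
  isomorphic e (@hypercube 4) \/
  (exists2 i, 1 <= i & isomorphic e (@calG i)) \/
  (exists2 j, 1 <= j & isomorphic e (@calH j)).

(* Main.v *)
Require Import Defs.
From mathcomp Require Import all_boot all_order all_algebra.
From mathcomp Require Import spectral ring zify.
Set Implicit Arguments.
Unset Strict Implicit.
Unset Printing Implicit Defensive.

(** Optimality is the equality case of Cauchy-Schwarz for the moduli of the
    eigenvalues, so it forces [S S^T = 4 I]: at any two distinct vertices, the
    common neighbours with equal signs are as many as those with opposite signs.
    Two distinct vertices thus have 0, 2 or 4 common neighbours.

    If two vertices have the same four neighbours, the sign condition splits
    these into two pairs of twins and propagates: one obtains a sequence of pairs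
    [P_k] in which every vertex of [P_k] has neighbourhood [P_(k-1) U P_(k+1)].
    The sequence closes up, and the graph is a cycle of length [m >= 3] with every
    vertex doubled: G_2 for [m = 3], calG for odd [m >= 5], calH for even [m].

    Otherwise, each pair of neighbours of a vertex [x] has exactly one further
    common neighbour. Exploring from [x] shows that the bipartite double cover
    has a component which is the 4-cube or the point-line non-incidence graph of
    the Fano plane. Either this component is the graph itself (Q_4 or G_3), or its
    two sides are the same vertex set; then the graph has 8 vertices, which gives
    G_1, or 7, which is impossible since a skew-symmetric matrix of odd order is
    singular. *)

(** * Isomorphisms given by explicit neighbourhoods *)

Lemma isomorphic_inj (T T' : finType) (e : rel T) (e' : rel T') (h : T -> T') :
  injective h -> #|T'| <= #|T| -> (forall x y, e x y = e' (h x) (h y)) ->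
  isomorphic e e'.
Proof. by move=> h_inj cardT' he; exists h => //; apply: inj_card_bij. Qed.

Lemma isomorphic_list_graph (T : finType) (e : rel T) (h : T -> vname) vs es :
  injective h -> (forall x, h x \in vs) -> size vs <= #|T| ->
  (forall x y, e x y = ((h x, h y) \in es) || ((h y, h x) \in es)) ->
  isomorphic e (list_graph (vs := vs) es).
Proof.
move=> h_inj h_vs size_vs he.
apply: (@isomorphic_inj _ _ _ _ (fun x => SeqSub (h_vs x))) => //.
  by move=> x y [] /h_inj.
apply: leq_trans size_vs; rewrite cardE -(size_map val).
apply: uniq_leq_size; first by rewrite map_inj_uniq ?enum_uniq //; apply: val_inj.
by move=> _ /mapP [y _ ->]; apply: (valP y).
Qed.

Lemma connected_closed (T : finType) (e : rel T) (s : seq T) x :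
  connected e -> x \in s -> {in s, forall y z, e y z -> z \in s} ->
  forall y, y \in s.
Proof.
move=> [_ conn] xs cl y; have /connectP [p ep ->] := conn x y.
by elim: p x xs ep {conn} => //= z p IH x xs /andP [/(cl _ xs)]; apply: IH.
Qed.

Lemma complete_nbrs (T : finType) (e : rel T) d x (l : seq T) :
  regular d e -> uniq l -> all (e x) l ->
  exists l', [/\ uniq (l ++ l'), size (l ++ l') = d & e x =1 mem (l ++ l')].
Proof.
move=> reg ul /allP el; exists [seq y <- enum (e x) | y \notin l].
set l2 := _ ++ _.
have ul2 : uniq l2.
  rewrite cat_uniq ul filter_uniq ?enum_uniq // andbT; apply/hasPn => y.
  by rewrite mem_filter => /andP [].
have el2 : e x =1 mem l2.
  move=> y; rewrite /= mem_cat mem_filter mem_enum.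
  by have [/el|] := boolP (y \in l).
split => //; rewrite -(card_uniqP ul2) -(reg x) /degree cardsE.
by apply: eq_card => y; apply/esym/el2.
Qed.

(* The neighbourhoods of the vertices listed in [s], given by positions in [s]. *)
Definition nbr_lists (T : finType) (e : rel T) (x0 : T) (s : seq T) (adj : seq (seq nat)) :=
  forall i, i < size s ->
    e (nth x0 s i) =1 mem [seq nth x0 s j | j <- nth [::] adj i].

(** The bound on the entries of [adj] keeps positions inside [s]; past its end [nth] would return
    [x0], which may itself be a vertex of [s]. *)
Lemma nbr_lists_adj (T : finType) (e : rel T) x0 s adj x y :
  uniq s -> nbr_lists e x0 s adj -> all (all (ltn^~ (size s))) adj ->
  x \in s -> y \in s -> e x y = (index y s \in nth [::] adj (index x s)).
Proof.
move=> us nb adj_s xs ys; rewrite -[in LHS](nth_index x0 xs) nb ?index_mem //=.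
rewrite -[in LHS](nth_index x0 ys).
apply/mapP/idP => [[j j_adj /eqP]|y_adj]; last by exists (index y s).
rewrite nth_uniq ?index_mem // => [/eqP-> //|].
have [adj_x|] := ltnP (index x s) (size adj); last first.
  by move=> h; rewrite nth_default in j_adj.
by have /allP/(_ _ (mem_nth [::] adj_x))/allP/(_ _ j_adj) := adj_s.
Qed.

(** A boolean on closed data: an isomorphism with a concrete graph, sending the [i]-th position to
    the [i]-th name of [l], is settled by evaluation. *)
Definition names_match (adj : seq (seq nat)) (l vs : seq vname) (es : seq (vname * vname)) :=
  [&& uniq l, all (mem vs) l, size vs <= size l, all (all (ltn^~ (size l))) adj &
      all (fun i => all (fun j => (j \in nth [::] adj i) ==
        ((nth U0 l i, nth U0 l j) \in es) || ((nth U0 l j, nth U0 l i) \in es))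
      (iota 0 (size l))) (iota 0 (size l))].

Lemma nbr_lists_isomorphic (T : finType) (e : rel T) x0 s adj l vs es :
  nbr_lists e x0 s adj -> uniq s -> (forall x, x \in s) -> size s = size l ->
  names_match adj l vs es -> isomorphic e (list_graph (vs := vs) es).
Proof.
move=> nb us s_all sl /and5P [ul /allP l_vs vs_l adj_l /allP match_l].
apply: (@isomorphic_list_graph _ _ (fun x => nth U0 l (index x s))).
- move=> x y /eqP; rewrite nth_uniq -?sl ?index_mem // => /eqP.
  by move/(congr1 (nth x0 s)); rewrite !nth_index.
- by move=> x; apply: l_vs; rewrite mem_nth // -sl index_mem.
- apply: leq_trans vs_l _; rewrite -sl -(card_uniqP us).
  exact/subset_leq_card/subsetP.
- move=> x y; rewrite (nbr_lists_adj us nb) ?sl //.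
  have idx z : index z s \in iota 0 (size l) by rewrite mem_iota -sl add0n index_mem s_all.
  by have /allP/(_ _ (idx y))/eqP := match_l _ (idx x).
Qed.

(** * Components of the bipartite double cover *)

Section BipartiteCover.
Variables (T : finType) (e : rel T) (rows cols : seq T).
Hypotheses (conn : connected e) (u_rows : uniq rows) (u_cols : uniq cols).
Hypotheses (rows_cols : {in rows, forall y z, e y z -> z \in cols}).
Hypotheses (cols_rows : {in cols, forall y z, e y z -> z \in rows}).

(** If the two sides share a vertex, the shared vertices form a set closed under adjacency, so by
    connectedness it is everything. Otherwise the disjoint union of the sides is such a closed
    set. *)
Lemma bipartite_or_equal x : x \in rows ->
  uniq (rows ++ cols) /\ (forall y, y \in rows ++ cols) \/ #|T| = size rows.
Proof.
move=> x_rows; have [/hasP [z zc zr]|disj] := boolP (has (mem rows) cols).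
  right; rewrite -(card_uniqP u_rows); apply/esym/eq_card => y; rewrite !inE.
  suff : y \in [seq y <- rows | y \in cols] by rewrite mem_filter => /andP [].
  apply: (connected_closed (x := z) conn); first by rewrite mem_filter zc.
  move=> {}y; rewrite mem_filter => /andP [yc yr] t eyt.
  by rewrite mem_filter (rows_cols yr) ?(cols_rows yc).
left; split; first by rewrite cat_uniq u_rows u_cols disj.
apply: (connected_closed (x := x) conn); first by rewrite mem_cat x_rows.
move=> y; rewrite mem_cat => /orP [yr|yc] t eyt; rewrite mem_cat.
  by rewrite (rows_cols yr) ?orbT.
by rewrite (cols_rows yc).
Qed.

End BipartiteCover.

(** * Graphs without twins *)

Definition common_nbrs (T : finType) (e : rel T) (x y : T) := [set z | e x z && e y z].

Lemma common_nbrs_count (T : finType) (e : rel T) x y l :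
  uniq l -> e y =1 mem l -> #|common_nbrs e x y| = count (e x) l.
Proof.
move=> ul el; rewrite -size_filter -(card_uniqP (filter_uniq _ ul)) cardsE.
by apply: eq_card => z; rewrite mem_filter -[z \in l]el.
Qed.

Section Regular4.
Variables (T : finType) (e : rel T).
Hypothesis reg : regular 4 e.

Lemma nbrs_of4 x l : uniq l -> size l = 4 -> all (e x) l -> e x =1 mem l.
Proof.
move=> ul sl el; have [l' [_]] := complete_nbrs reg ul el.
by rewrite size_cat sl -[RHS]addn0 => /addnI/size0nil ->; rewrite cats0.
Qed.

Lemma nbrs_of3 x a b c : uniq [:: a; b; c] -> e x a -> e x b -> e x c ->
  exists z, uniq [:: a; b; c; z] /\ e x =1 mem [:: a; b; c; z].
Proof.
move=> ul xa xb xc; have := complete_nbrs (x := x) reg ul.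
by rewrite /= xa xb xc => /(_ isT) [[|z [|? ?]] [u //= _ ex]]; exists z.
Qed.

Lemma nbrs_of2 x a b : a != b -> e x a -> e x b ->
  exists z w, uniq [:: a; b; z; w] /\ e x =1 mem [:: a; b; z; w].
Proof.
move=> ab xa xb; have ul : uniq [:: a; b] by rewrite /= inE ab.
have := complete_nbrs (x := x) reg ul.
by rewrite /= xa xb => /(_ isT) [[|z [|w [|? ?]]] [u //= _ ex]]; exists z, w.
Qed.

Lemma nbrs_of0 x :
  exists a b c d, uniq [:: a; b; c; d] /\ e x =1 mem [:: a; b; c; d].
Proof.
have [[|a [|b [|c [|d [|? ?]]]]] [u //= _ ex]] :=
  complete_nbrs (x := x) (l := [::]) reg isT isT.
by exists a, b, c, d.
Qed.

End Regular4.

Lemma uniq4P (T : eqType) (a b c d : T) : uniq [:: a; b; c; d] ->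
  [/\ a <> b, a <> c, a <> d & [/\ b <> c, b <> d & c <> d]].
Proof.
rewrite /= !inE !negb_or.
by move=> /and4P [/and3P [/eqP ? /eqP ? /eqP ?] /andP [/eqP ? /eqP ?] /eqP ? _].
Qed.

(** Two vertices are told apart by a recorded inequality, or by a third vertex adjacent to one of
    them and not to the other. *)
Ltac neq := apply/eqP; let E := fresh in intro E; match type of E with ?a = ?b =>
  match goal with
  | H : a <> b |- _ => exact (H E)
  | H : b <> a |- _ => exact (H (esym E))
  | H1 : ?e a ?c = _, H2 : ?e b ?c = _ |- _ => by rewrite E H2 in H1
  | H1 : ?e ?c a = _, H2 : ?e ?c b = _ |- _ => by rewrite E H2 in H1
  end end.
Ltac uniqs := by rewrite /= ?inE ?negb_or; repeat (apply/andP; split); first [neq | done].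
Ltac facts := repeat match goal with
  | H : ?e ?x ?y = true |- context [?e ?x ?y] => rewrite H
  | H : ?e ?x ?y = false |- context [?e ?x ?y] => rewrite H
  end.
Ltac memF N := by rewrite N /= ?inE; apply/negbTE; rewrite ?negb_or;
  repeat (apply/andP; split); neq.
Ltac memT N := by rewrite N /= ?inE ?eqxx ?orbT.

Section NoTwins.
Variables (T : finType) (e : rel T).
Hypotheses (symE : symmetric e) (irrE : irreflexive e) (conn : connected e).
Hypothesis reg : regular 4 e.
Hypothesis common_02 : forall x y, x != y -> #|common_nbrs e x y| \in [:: 0; 2].

Ltac facts_sym := rewrite /=; facts; repeat match goal with
  | H : e ?x ?y = true |- context [e ?y ?x] => rewrite (symE y x) H
  end.

(** The working form of [common_02]: once three of the summands are known, parity determines the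
    fourth. *)
Lemma pair_rule p q a b c d : p != q -> uniq [:: a; b; c; d] ->
  e q =1 mem [:: a; b; c; d] -> e p a + e p b + e p c + e p d \in [:: 0; 2].
Proof.
move=> pq u eq; have := common_02 pq.
by rewrite (common_nbrs_count _ u eq) /= addn0 !addnA.
Qed.

Lemma pair_rule_sym p q a b c d : p != q -> uniq [:: a; b; c; d] ->
  e q =1 mem [:: a; b; c; d] -> e a p + e b p + e c p + e d p \in [:: 0; 2].
Proof. by move=> pq u eq; rewrite !(symE _ p) (pair_rule pq u eq). Qed.

Lemma no_third_common x y a b c : x != y -> uniq [:: a; b; c] ->
  all (e x) [:: a; b; c] -> all (e y) [:: a; b; c] -> False.
Proof.
move=> xy u /allP ex /allP ey; have := common_02 xy.
have : 2 < #|common_nbrs e x y|.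
  by apply/card_geqP; exists [:: a; b; c]; split=> // z zl; rewrite inE ex ?ey.
by rewrite !inE => + /orP [] /eqP => h1 h2; rewrite h2 in h1.
Qed.

(** Since [x] is a common neighbour of [a] and [b], there are exactly two, and [r] is the other one.
    A third neighbour of [x] adjacent to [r] would give [x] and [r] three common neighbours. *)
Lemma second_common x a b : a != b -> e x a -> e x b ->
  exists r, [/\ r != x, e r a, e r b &
    forall c, c != a -> c != b -> e x c -> e r c = false].
Proof.
move=> ab xa xb; have xC : x \in common_nbrs e a b by rewrite inE !(symE _ x) xa.
have /card_gt1P [y [z [yC zC yz]]] : 1 < #|common_nbrs e a b|.
  by have := common_02 ab; rewrite !inE (cardD1 x) xC => /orP [] // /eqP->.
have [r rx] : exists2 r, r != x & r \in common_nbrs e a b.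
  by have [yx|] := eqVneq y x; [exists z; rewrite // -yx eq_sym | exists y].
rewrite inE !(symE _ r) => /andP [ra rb]; exists r; split=> // c ca cb xc.
apply/negP => rc; apply: (no_third_common (a := a) (b := b) (c := c) rx).
- by rewrite /= !inE negb_or ab !(eq_sym _ c) ca cb.
- by rewrite /= ra rb rc.
- by rewrite /= xa xb xc.
Qed.

(* [r_ij] is the common neighbour of [c_i] and [c_j] other than [x]. *)
Lemma level2 x : exists c1 c2 c3 c4 r12 r13 r14 r23 r24 r34,
  [/\ uniq [:: c1; c2; c3; c4], e x =1 mem [:: c1; c2; c3; c4] &
   [seq [seq e r c | c <- [:: c1; c2; c3; c4]]
     | r <- [:: x; r12; r13; r14; r23; r24; r34]] =
   [:: [:: true; true; true; true]; [:: true; true; false; false];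
       [:: true; false; true; false]; [:: true; false; false; true];
       [:: false; true; true; false]; [:: false; true; false; true];
       [:: false; false; true; true]]].
Proof.
have [c1 [c2 [c3 [c4 [u xN]]]]] := nbrs_of0 reg x.
have {u} [u] := (u, u); rewrite /= !inE !negb_or.
move=> /and4P [/and3P [n12 n13 n14] /andP [n23 n24] n34 _].
have [x1 x2 x3 x4] : [/\ e x c1, e x c2, e x c3 & e x c4].
  by rewrite !xN /= !inE !eqxx !orbT.
have [r12 [_ a1 a2 a]] := second_common n12 x1 x2.
have [r13 [_ b1 b3 b]] := second_common n13 x1 x3.
have [r14 [_ d1 d4 d]] := second_common n14 x1 x4.
have [r23 [_ f2 f3 f]] := second_common n23 x2 x3.
have [r24 [_ g2 g4 g]] := second_common n24 x2 x4.
have [r34 [_ h3 h4 h]] := second_common n34 x3 x4.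
exists c1, c2, c3, c4, r12, r13, r14, r23, r24, r34; split=> //.
rewrite !(a1, a2, b1, b3, d1, d4, f2, f3, g2, g4, h3, h4, x1, x2, x3, x4).
by rewrite !(a, b, d, f, g, h) // eq_sym.
Qed.


(* In [cube_adj] the positions 0 to 7 are [x], [r12], [r13], [r14], [r23], [r24],
   [r34] and a vertex [w]; in [fano_adj] there is no [w]. The remaining positions
   are the four neighbours of [x], followed by the other neighbours of the [r_ij]. *)
Definition cube_adj := [::
  [:: 8; 9; 10; 11]; [:: 8; 9; 12; 13]; [:: 8; 10; 12; 14]; [:: 8; 11; 13; 14];
  [:: 9; 10; 12; 15]; [:: 9; 11; 13; 15]; [:: 10; 11; 14; 15]; [:: 12; 13; 14; 15];
  [:: 0; 1; 2; 3]; [:: 0; 1; 4; 5]; [:: 0; 2; 4; 6]; [:: 0; 3; 5; 6];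
  [:: 1; 2; 4; 7]; [:: 1; 3; 5; 7]; [:: 2; 3; 6; 7]; [:: 4; 5; 6; 7]].

Definition fano_adj := [::
  [:: 7; 8; 9; 10]; [:: 7; 8; 11; 12]; [:: 7; 9; 11; 13]; [:: 7; 10; 12; 13];
  [:: 8; 9; 12; 13]; [:: 8; 10; 11; 13]; [:: 9; 10; 11; 12];
  [:: 0; 1; 2; 3]; [:: 0; 1; 4; 5]; [:: 0; 2; 4; 6]; [:: 0; 3; 5; 6];
  [:: 1; 2; 5; 6]; [:: 1; 3; 4; 6]; [:: 2; 3; 4; 5]].

(* [rows] and [cols] are the two sides of a component of the bipartite double
   cover, so they may share vertices. *)
Lemma cube_or_fano x :
  (exists rows cols, [/\ uniq rows, uniq cols, size rows = 8, size cols = 8 &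
    nbr_lists e x (rows ++ cols) cube_adj]) \/
  (exists rows cols, [/\ uniq rows, uniq cols, size rows = 7, size cols = 7 &
    nbr_lists e x (rows ++ cols) fano_adj]).
Proof.
have [c1 [c2 [c3 [c4 [r12 [r13 [r14 [r23 [r24 [r34 [u xN]]]]]]]]]]] := level2 x.
(* Injectivity turns the table into one adjacency fact per entry; [facts] and [neq] draw on
   these. *)
case; intros.
have c1N : e c1 =1 mem [:: x; r12; r13; r14].
  by apply: nbrs_of4; rewrite // ?(symE c1) /= ?(symE c1); facts; [uniqs|].
have c2N : e c2 =1 mem [:: x; r12; r23; r24].
  by apply: nbrs_of4; rewrite // /= ?(symE c2); facts; [uniqs|].
have c3N : e c3 =1 mem [:: x; r13; r23; r34].
  by apply: nbrs_of4; rewrite // /= ?(symE c3); facts; [uniqs|].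
have c4N : e c4 =1 mem [:: x; r14; r24; r34].
  by apply: nbrs_of4; rewrite // /= ?(symE c4); facts; [uniqs|].
(* Such a [z] differs from every [c_i], and [x] contributes nothing to the common neighbours of [z]
   and [c_i], so only the three [r_ij] at [c_i] are counted. *)
have col_rules z : e x z = false ->
    [/\ e r12 z + e r13 z + e r14 z \in [:: 0; 2],
        e r12 z + e r23 z + e r24 z \in [:: 0; 2],
        e r13 z + e r23 z + e r34 z \in [:: 0; 2] &
        e r14 z + e r24 z + e r34 z \in [:: 0; 2]].
  move=> xz; split.
  - have := @pair_rule_sym z c1 _ _ _ _ _ _ c1N; rewrite xz; apply; [neq|uniqs].
  - have := @pair_rule_sym z c2 _ _ _ _ _ _ c2N; rewrite xz; apply; [neq|uniqs].
  - have := @pair_rule_sym z c3 _ _ _ _ _ _ c3N; rewrite xz; apply; [neq|uniqs].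
  - have := @pair_rule_sym z c4 _ _ _ _ _ _ c4N; rewrite xz; apply; [neq|uniqs].
(* Of [c1] and [c2], only [c1] is adjacent to [r13], so exactly one of the other two neighbours of
   [r12] is adjacent to [r13]; it is called [a]. *)
have [a [b [/[dup] u12 /uniq4P [? ? ? [? ? ?]] r12N a13]]] : exists a b,
    [/\ uniq [:: c1; c2; a; b], e r12 =1 mem [:: c1; c2; a; b] & e r13 a = true].
  have [a [b [u12 r12N]]] := nbrs_of2 (x := r12) (a := c1) (b := c2) reg
    ltac:(neq) ltac:(by facts) ltac:(by facts).
  have := @pair_rule r13 r12 _ _ _ _ ltac:(neq) u12 r12N; facts.
  case E : (e r13 a); first by exists a, b.
  case F : (e r13 b) => // _; exists b, a; split=> //.
    by case/uniq4P: u12 => ? ? ? [? ? ?]; uniqs.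
  by move=> z; rewrite r12N /= !inE; do !case: eqP.
have r12a : e r12 a = true by memT r12N.
have r12b : e r12 b = true by memT r12N.
have xa : e x a = false by memF xN.
have xb : e x b = false by memF xN.
have b13 : e r13 b = false.
  by have := @pair_rule r13 r12 _ _ _ _ ltac:(neq) u12 r12N; facts; case: (e r13 b).
have [+ _ _ _] := col_rules _ xa; facts => a14.
have {a14} a14 : e r14 a = false by case: (e r14 a) a14.
have [+ _ _ _] := col_rules _ xb; facts => b14.
have {b14} b14 : e r14 b = true by case: (e r14 b) b14.
have row23 := @pair_rule r23 r12 _ _ _ _ ltac:(neq) u12 r12N.
have row24 := @pair_rule r24 r12 _ _ _ _ ltac:(neq) u12 r12N.
have [_ + + _] := col_rules _ xa; have [_ + + _] := col_rules _ xb; move: row23.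
(* As [r12] and [r23] share [c2] but not [c1], exactly one of [a], [b] is adjacent to [r23]. The
   choice [a] leads to the cube, the choice [b] to the Fano plane. *)
case a23 : (e r23 a); facts.
- case b23 : (e r23 b) => // _; case b24 : (e r24 b) => //= _.
  case b34 : (e r34 b) => //= _; case a24 : (e r24 a) => //= _.
  case a34 : (e r34 a) => //= _ {row24}.
  (* The last neighbour [w] of [a] turns out to be the antipode of [x] in the cube. *)
  have [w [/uniq4P [? ? ? [? ? ?]] aN]] : exists w,
      uniq [:: r12; r13; r23; w] /\ e a =1 mem [:: r12; r13; r23; w].
    by apply: (nbrs_of3 reg); [uniqs | rewrite symE; facts..].
  have ua : uniq [:: r12; r13; r23; w] by uniqs.
  have wa : e w a = true by rewrite symE; memT aN.
  have wb : e w b = true.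
    by have := @pair_rule_sym b a _ _ _ _ ltac:(neq) ua aN; facts; case: (e w b).
  have [g [/uniq4P [? ? ? [? ? ?]] r13N]] : exists g,
      uniq [:: c1; c3; a; g] /\ e r13 =1 mem [:: c1; c3; a; g].
    by apply: (nbrs_of3 reg); [uniqs | facts..].
  have u13 : uniq [:: c1; c3; a; g] by uniqs.
  have g13 : e r13 g = true by memT r13N.
  have xg : e x g = false by memF xN.
  have g12 : e r12 g = false by memF r12N.
  have g23 : e r23 g = false.
    by have := @pair_rule r23 r13 _ _ _ _ ltac:(neq) u13 r13N; facts; case: (e r23 g).
  have [+ + + _] := col_rules _ xg; facts.
  case g14 : (e r14 g) => //= _; case g24 : (e r24 g) => //= _; case g34 : (e r34 g) => //= _.
  have wg : e w g = true.
    by have := @pair_rule_sym g a _ _ _ _ ltac:(neq) ua aN; facts; case: (e w g).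
  have [d [/uniq4P [? ? ? [? ? ?]] r23N]] : exists d,
      uniq [:: c2; c3; a; d] /\ e r23 =1 mem [:: c2; c3; a; d].
    by apply: (nbrs_of3 reg); [uniqs | facts..].
  have d23 : e r23 d = true by memT r23N.
  have xd : e x d = false by memF xN.
  have d12 : e r12 d = false by memF r12N.
  have d13 : e r13 d = false by memF r13N.
  have [_ + + +] := col_rules _ xd; facts.
  case d24 : (e r24 d) => //= _; case d34 : (e r34 d) => //= _; case d14 : (e r14 d) => //= _.
  have wd : e w d = true.
    by have := @pair_rule_sym d a _ _ _ _ ltac:(neq) ua aN; facts; case: (e w d).
  left; exists [:: x; r12; r13; r14; r23; r24; r34; w], [:: c1; c2; c3; c4; a; b; g; d].
  split; [uniqs | uniqs | by [] | by [] |].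
  do 16 (case=> [_|]; first by [|apply: (nbrs_of4 reg);
    [uniqs | by [] | facts_sym]]); by [].
- case b23 : (e r23 b) => // _; case b24 : (e r24 b) => //= _.
  case b34 : (e r34 b) => //= _; case a24 : (e r24 a) => //= _.
  case a34 : (e r34 a) => //= _ {row24}.
  (* The last neighbour [g] of [r13] is the seventh column; here it is also adjacent to [r23], and
     the component closes without a vertex [w]. *)
  have [g [/uniq4P [? ? ? [? ? ?]] r13N]] : exists g,
      uniq [:: c1; c3; a; g] /\ e r13 =1 mem [:: c1; c3; a; g].
    by apply: (nbrs_of3 reg); [uniqs | facts..].
  have u13 : uniq [:: c1; c3; a; g] by uniqs.
  have g13 : e r13 g = true by memT r13N.
  have xg : e x g = false by memF xN.
  have g12 : e r12 g = false by memF r12N.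
  have g23 : e r23 g = true.
    by have := @pair_rule r23 r13 _ _ _ _ ltac:(neq) u13 r13N; facts; case: (e r23 g).
  have [+ + + _] := col_rules _ xg; facts.
  case g14 : (e r14 g) => //= _; case g24 : (e r24 g) => //= _; case g34 : (e r34 g) => //= _.
  right; exists [:: x; r12; r13; r14; r23; r24; r34], [:: c1; c2; c3; c4; a; b; g].
  split; [uniqs | uniqs | by [] | by [] |].
  do 14 (case=> [_|]; first by [|apply: (nbrs_of4 reg);
    [uniqs | by [] | facts_sym]]); by [].
Qed.

End NoTwins.

(** * Recognising the hypercube, [G3] and [G1] *)

Lemma uniq_size_mem (T : finType) (s : seq T) : uniq s -> size s = #|T| -> forall x, x \in s.
Proof.
by move=> /card_uniqP <- cards x; rewrite (subset_cardP cards (subset_predT _)).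
Qed.

(** Counterpart of [nbrs_of4] for a neighbourhood found by excluding all other vertices. *)
Lemma nbrs_sub4 (T : finType) (e : rel T) x l :
  regular 4 e -> uniq l -> size l = 4 -> (forall z, e x z -> z \in l) -> e x =1 mem l.
Proof.
move=> reg /card_uniqP ul sl sub z.
have card_eq : #|[set y | e x y]| = #|l| by rewrite ul sl; apply: reg.
have /(subset_cardP card_eq)/(_ z) : [set y | e x y] \subset l.
  by apply/subsetP => y; rewrite inE; apply: sub.
by rewrite inE.
Qed.

Lemma nbr_lists_bipartite (T : finType) (e : rel T) x0 rows cols adj :
  nbr_lists e x0 (rows ++ cols) adj ->
  all (all (fun j => size rows <= j < size rows + size cols)) (take (size rows) adj) ->
  all (all (fun j => j < size rows)) (drop (size rows) adj) ->
  size adj = size rows + size cols ->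
  {in rows, forall y z, e y z -> z \in cols} /\
  {in cols, forall y z, e y z -> z \in rows}.
Proof.
move=> nb adj_r adj_c size_adj; split=> y y_in z.
- have iy : index y rows < size rows by rewrite index_mem.
  have {1}-> : y = nth x0 (rows ++ cols) (index y rows) by rewrite nth_cat iy nth_index.
  rewrite nb ?size_cat ?(ltn_addr _ iy) //.
  case/mapP => j jy ->; have : nth [::] adj (index y rows) \in take (size rows) adj.
    by rewrite -(nth_take _ iy) mem_nth // size_takel // size_adj leq_addr.
  move/(allP adj_r)/allP/(_ _ jy) => /andP [j1 j2].
  by rewrite nth_cat ltnNge j1 /= mem_nth // ltn_subLR.
- have iy : index y cols < size cols by rewrite index_mem.
  have {1}-> : y = nth x0 (rows ++ cols) (size rows + index y cols).
    by rewrite nth_cat ltnNge leq_addr /= addKn nth_index.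
  rewrite nb ?size_cat ?ltn_add2l //.
  case/mapP => j jy ->; have : nth [::] adj (size rows + index y cols) \in drop (size rows) adj.
    by rewrite -nth_drop mem_nth // size_drop size_adj addKn.
  move/(allP adj_c)/allP/(_ _ jy) => j1.
  by rewrite nth_cat j1 mem_nth.
Qed.

Definition bits_vertex (l : seq bool) : {ffun 'I_4 -> bool} := [ffun i : 'I_4 => nth false l i].

(** Expresses adjacency as a Hamming distance on bit lists, which can be evaluated. *)
Lemma hypercube_bits k l :
  hypercube (bits_vertex k) (bits_vertex l) =
  (\sum_(i < 4) (nth false k i != nth false l i) == 1).
Proof.
rewrite /hypercube -sum1_card big_mkcond; congr (_ == 1).
by apply: eq_bigr => i _; rewrite inE !ffunE; case: (_ != _).
Qed.

Lemma bits_vertex_inj k l : size k = 4 -> size l = 4 -> bits_vertex k = bits_vertex l -> k = l.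
Proof.
move=> k4 l4 /ffunP kl; apply: (@eq_from_nth _ false); rewrite ?k4 ?l4 // => i i4.
by have := kl (Ordinal i4); rewrite !ffunE.
Qed.

(* Vertices of even weight in the order of the rows [x], [r_ij], [w] of
   [cube_or_fano], then those of odd weight in the order of its columns. *)
Definition cube_bits : seq (seq bool) := [seq [seq b == 1 | b <- l] | l <- [::
  [:: 0;0;0;0]; [:: 1;1;0;0]; [:: 1;0;1;0]; [:: 1;0;0;1];
  [:: 0;1;1;0]; [:: 0;1;0;1]; [:: 0;0;1;1]; [:: 1;1;1;1];
  [:: 1;0;0;0]; [:: 0;1;0;0]; [:: 0;0;1;0]; [:: 0;0;0;1];
  [:: 1;1;1;0]; [:: 1;1;0;1]; [:: 1;0;1;1]; [:: 0;1;1;1]]].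

(** Vertices of [G3] in the order of the positions of [fano_adj], rows first. *)
Definition fano_names := [:: U0; U 3; U 4; V0; W0; V 3; V 4; U 1; V 1; V 2; U 2; V 5; U 5; U 6].

Lemma cube_isomorphic (T : finType) (e : rel T) x s :
  nbr_lists e x s cube_adj -> size s = 16 -> uniq s -> (forall y, y \in s) ->
  isomorphic e (@hypercube 4).
Proof.
move=> nb s16 us s_all; have idx y : index y s < 16 by rewrite -s16 index_mem.
have size4 y : size (nth [::] cube_bits (index y s)) = 4.
  by apply/eqP/(allP (isT : all (fun l => size l == 4) cube_bits))/mem_nth/idx.
apply: (@isomorphic_inj _ _ _ _ (fun y => bits_vertex (nth [::] cube_bits (index y s)))).
- move=> y z /bits_vertex_inj/eqP; rewrite !size4 nth_uniq ?idx // => /(_ erefl erefl)/eqP.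
  by move/(congr1 (nth x s)); rewrite !nth_index.
- by rewrite card_ffun card_bool card_ord -[2 ^ 4]s16 -(card_uniqP us) max_card.
- move=> y z; rewrite (nbr_lists_adj us nb) ?s16 // hypercube_bits !big_ord_recl big_ord0 /=.
  pose sum4 k l := (nth false k 0 != nth false l 0) + ((nth false k 1 != nth false l 1) +
    ((nth false k 2 != nth false l 2) + ((nth false k 3 != nth false l 3) + 0))).
  have /allP/(_ (index y s)) : all (fun i => all (fun j => (j \in nth [::] cube_adj i) ==
    (sum4 (nth [::] cube_bits i) (nth [::] cube_bits j) == 1)) (iota 0 16)) (iota 0 16).
    by vm_compute.
  rewrite mem_iota idx => /(_ isT)/allP/(_ (index z s)); rewrite mem_iota idx => /(_ isT)/eqP ->.
  by [].
Qed.

Section NoTwins.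
Variables (T : finType) (e : rel T).
Hypotheses (symE : symmetric e) (irrE : irreflexive e) (conn : connected e).
Hypothesis reg : regular 4 e.
Hypothesis common_02 : forall x y, x != y -> #|common_nbrs e x y| \in [:: 0; 2].

(** The vertices [x], [a], [b], [c] form a [K_4]. The outside neighbours [a'], [b'], [c'] are
    distinct, as a coincidence would create three common neighbours. Together with [d] this exhausts
    the eight vertices, and degree 4 makes [d], [a'], [b'], [c'] the second [K_4]. *)
Lemma triangle_G1 x a b c d : #|T| = 8 ->
  uniq [:: a; b; c; d] -> e x =1 mem [:: a; b; c; d] ->
  e a b = true -> e a c = true -> e b c = true ->
  e a d = false -> e b d = false -> e c d = false ->
  isomorphic e G1.
Proof.
move=> T8 u xN ab ac bc ad bd cd; have [? ? ? [? ? ?]] := uniq4P u.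
have xa : e x a = true by memT xN.
have xb : e x b = true by memT xN.
have xc : e x c = true by memT xN.
have xd : e x d = true by memT xN.
have xx := irrE x.
have aa := irrE a. have bb := irrE b. have cc := irrE c. have dd := irrE d.
have [ax bx cx dx] : [/\ e a x = true, e b x = true, e c x = true & e d x = true].
  by rewrite !(symE _ x).
have [ba ca cb] : [/\ e b a = true, e c a = true & e c b = true].
  by rewrite (symE b) (symE c a) (symE c b).
have [da db dc] : [/\ e d a = false, e d b = false & e d c = false].
  by rewrite !(symE d).
have [a' [/uniq4P [? ? ? [? ? ?]] aN]] : exists a',
    uniq [:: x; b; c; a'] /\ e a =1 mem [:: x; b; c; a'].
  by apply: (nbrs_of3 reg); [uniqs | facts..].
have [b' [/uniq4P [? ? ? [? ? ?]] bN]] : exists b',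
    uniq [:: x; a; c; b'] /\ e b =1 mem [:: x; a; c; b'].
  by apply: (nbrs_of3 reg); [uniqs | facts..].
have [c' [/uniq4P [? ? ? [? ? ?]] cN]] : exists c',
    uniq [:: x; a; b; c'] /\ e c =1 mem [:: x; a; b; c'].
  by apply: (nbrs_of3 reg); [uniqs | facts..].
have aa' : e a a' = true by memT aN.
have bb' : e b b' = true by memT bN.
have cc' : e c c' = true by memT cN.
have xa' : e x a' = false by memF xN.
have xb' : e x b' = false by memF xN.
have xc' : e x c' = false by memF xN.
have a'b' : a' <> b'.
  move=> E; apply: (@no_third_common _ _ common_02 a b x c a'); [neq|uniqs|..].
    by rewrite /= ax ac aa'.
  by rewrite /= bx bc E bb'.
have a'c' : a' <> c'.
  move=> E; apply: (@no_third_common _ _ common_02 a c x b a'); [neq|uniqs|..].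
    by rewrite /= ax ab aa'.
  by rewrite /= cx cb E cc'.
have b'c' : b' <> c'.
  move=> E; apply: (@no_third_common _ _ common_02 b c x a b'); [neq|uniqs|..].
    by rewrite /= bx ba bb'.
  by rewrite /= cx ca E cc'.
have ab' : e a b' = false by memF aN.
have ac' : e a c' = false by memF aN.
have ba' : e b a' = false by memF bN.
have bc' : e b c' = false by memF bN.
have ca' : e c a' = false by memF cN.
have cb' : e c b' = false by memF cN.
pose s := [:: x; a; b; c; d; a'; b'; c'].
have us : uniq s by uniqs.
have s_all : forall y, y \in s by apply: uniq_size_mem; rewrite ?T8.
have dN : e d =1 mem [:: x; a'; b'; c'].
  apply: nbrs_sub4 => //; first by uniqs.
  move=> z; have := s_all z; rewrite !inE.
  by repeat case: eqP => [->|_] //=; facts.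
have a'N : e a' =1 mem [:: a; d; b'; c'].
  apply: nbrs_sub4 => //; first by uniqs.
  move=> z; rewrite symE; have := s_all z; rewrite !inE.
  by repeat case: eqP => [->|_] //=; facts; rewrite // irrE.
have b'N : e b' =1 mem [:: b; d; a'; c'].
  apply: nbrs_sub4 => //; first by uniqs.
  move=> z; rewrite symE; have := s_all z; rewrite !inE.
  by repeat case: eqP => [->|_] //=; facts; rewrite // irrE.
have c'N : e c' =1 mem [:: c; d; a'; b'].
  apply: nbrs_sub4 => //; first by uniqs.
  move=> z; rewrite symE; have := s_all z; rewrite !inE.
  by repeat case: eqP => [->|_] //=; facts; rewrite // irrE.
apply: (@nbr_lists_isomorphic _ _ x s [:: [:: 1; 2; 3; 4]; [:: 0; 2; 3; 5];
  [:: 0; 1; 3; 6]; [:: 0; 1; 2; 7]; [:: 0; 5; 6; 7]; [:: 1; 4; 6; 7];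
  [:: 2; 4; 5; 7]; [:: 3; 4; 5; 6]] (G1_vertices)) => //.
by do 8 (case=> [_|]; first by []).
Qed.

(** Each neighbour of [x] has 0 or 2 neighbours among the other three, so the neighbourhood of [x]
    induces a triangle with an isolated vertex, a 4-cycle or no edge. In a 4-cycle, opposite
    vertices have three common neighbours counting [x], so that case is impossible. *)
Lemma card8_G1 : #|T| = 8 -> isomorphic e G1.
Proof.
move=> T8; have /card_gt0P [x _] : 0 < #|T| by rewrite T8.
have [a [b [c [d [u xN]]]]] := nbrs_of0 reg x.
have [? ? ? [? ? ?]] := uniq4P u.
have xa : e x a = true by memT xN.
have xb : e x b = true by memT xN.
have xc : e x c = true by memT xN.
have xd : e x d = true by memT xN.
have xx := irrE x.
have [ax bx cx dx] : [/\ e a x = true, e b x = true, e c x = true & e d x = true].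
  by rewrite !(symE _ x).
have ra := @pair_rule _ _ common_02 a x _ _ _ _ ltac:(neq) u xN.
have rb := @pair_rule _ _ common_02 b x _ _ _ _ ltac:(neq) u xN.
have rc := @pair_rule _ _ common_02 c x _ _ _ _ ltac:(neq) u xN.
have rd := @pair_rule _ _ common_02 d x _ _ _ _ ltac:(neq) u xN.
move: ra rb rc rd; rewrite !irrE (symE b a) !(symE c a) !(symE c b).
rewrite !(symE d a) !(symE d b) (symE d c).
case ab : (e a b); case ac : (e a c); case ad : (e a d); case bc : (e b c);
  case bd : (e b d); case cd : (e c d) => //= _ _ _ _.
- by apply: (@triangle_G1 x a b c d).
- case: (@no_third_common _ _ common_02 a d x b c); [neq|uniqs|..].
    by rewrite /= ax ab ac.
  by rewrite /= dx !(symE d) bd cd.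
- case: (@no_third_common _ _ common_02 a c x b d); [neq|uniqs|..].
    by rewrite /= ax ab ad.
  by rewrite /= cx (symE c) bc cd.
- apply: (@triangle_G1 x a b d c) => //; [uniqs | | by rewrite symE].
  by move=> z; rewrite xN /= !inE; do !case: eqP.
- case: (@no_third_common _ _ common_02 a b x c d); [neq|uniqs|..].
    by rewrite /= ax ac ad.
  by rewrite /= bx bc bd.
- apply: (@triangle_G1 x a c d b) => //; [uniqs | | by rewrite symE | by rewrite symE].
  by move=> z; rewrite xN /= !inE; do !case: eqP.
- apply: (@triangle_G1 x b c d a) => //; [uniqs | | by rewrite symE..].
  by move=> z; rewrite xN /= !inE; do !case: eqP.
(* No edge among [a], [b], [c], [d]: with eight vertices in all, both [a] and [b] must be adjacent
   to [x] and to the same three remaining vertices. *)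
have [p [q [r [/uniq4P [? ? ? [? ? ?]] aN]]]] : exists p q r,
    uniq [:: x; p; q; r] /\ e a =1 mem [:: x; p; q; r].
  have := complete_nbrs (x := a) reg (isT : uniq [:: x]).
  by rewrite /= ax => /(_ isT) [[|p [|q [|r [|? ?]]]] [? //= _ ?]]; exists p, q, r.
have [ap aq ar] : [/\ e a p = true, e a q = true & e a r = true].
  by split; memT aN.
have [xp xq xr] : [/\ e x p = false, e x q = false & e x r = false].
  have aa := irrE a; by split; memF xN.
pose s := [:: x; a; b; c; d; p; q; r].
have us : uniq s by uniqs.
have s_all : forall y, y \in s by apply: uniq_size_mem; rewrite ?T8.
have bN : e b =1 mem [:: x; p; q; r].
  apply: nbrs_sub4 => //; first by uniqs.
  move=> z; have := s_all z; rewrite !inE.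
  by repeat case: eqP => [->|_] //=; rewrite ?irrE ?(symE b a) ?bc ?bd ?ab.
case: (@no_third_common _ _ common_02 a b x p q); [neq|uniqs|..].
  by rewrite /= ax ap aq.
by rewrite /= !bN /= !inE !eqxx !orbT.
Qed.

Hypothesis even_T : ~~ odd #|T|.

Lemma no_twins_in_F : in_F e.
Proof.
have /card_gt0P [x _] := conn.1.
have [[rows [cols [ur uc r8 c8 nb]]]|[rows [cols [ur uc r7 c7 nb]]]] :=
  cube_or_fano symE reg common_02 x.
- have [|||rc cr] := nbr_lists_bipartite nb; rewrite ?r8 ?c8 //.
  have [y y_rows] : exists y, y \in rows by case: (rows) r8 => // y ? _; exists y; rewrite mem_head.
  have [[us s_all]|T8] := bipartite_or_equal conn ur uc rc cr y_rows.
    right; right; right; left; apply: (cube_isomorphic nb) => //.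
    by rewrite size_cat r8 c8.
  by left; apply: card8_G1; rewrite T8.
- have [|||rc cr] := nbr_lists_bipartite nb; rewrite ?r7 ?c7 //.
  have [y y_rows] : exists y, y \in rows by case: (rows) r7 => // y ? _; exists y; rewrite mem_head.
  have [[us s_all]|T7] := bipartite_or_equal conn ur uc rc cr y_rows.
    right; right; left; apply: (nbr_lists_isomorphic (l := fano_names) nb) => //.
    by rewrite size_cat r7 c7.
  by have := even_T; rewrite T7 r7.
Qed.

End NoTwins.

(** * Graphs with twins *)

(** The wrap-around is spelled out rather than taken modulo [m], which keeps adjacency within linear
    arithmetic. *)
Definition cycle_adj (m i j : nat) : bool :=
  [|| j == i.+1, i == j.+1, (i == 0) && (j == m.-1) | (j == 0) && (i == m.-1)].

(** For [m >= 3], the lexicographic product of the [m]-cycle with two isolated vertices. *)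
Definition doubled_cycle (m : nat) : rel ('I_m * bool) :=
  fun x y => cycle_adj m x.1 y.1.

Section Balanced.
Variables (T : finType) (e o : rel T).
Hypotheses (symE : symmetric e) (irrE : irreflexive e) (conn : connected e).
Hypothesis reg : regular 4 e.
Hypothesis anti : forall x y, e x y -> o y x = ~~ o x y.
Hypothesis balanced : forall x y, x != y ->
  #|[set z | e x z && e y z && (o x z == o y z)]|
  = #|[set z | e x z && e y z && (o x z != o y z)]|.

(** Balance splits the common neighbours into two classes of equal size, and there are at most four
    of them. *)
Lemma common_024 x y : x != y -> #|common_nbrs e x y| \in [:: 0; 2; 4].
Proof.
move=> xy.
have split_common : #|common_nbrs e x y| =
    #|[set z | e x z && e y z && (o x z == o y z)]| +
    #|[set z | e x z && e y z && (o x z != o y z)]|.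
  rewrite -(cardsID [set z | o x z == o y z]); congr (_ + _); apply: eq_card => z;
  by rewrite !inE // andbC.
have : #|common_nbrs e x y| <= 4.
  by rewrite -(reg x) subset_leq_card //; apply/subsetP => z; rewrite !inE => /andP [].
rewrite split_common balanced // addnn.
by case: #|_| => [|[|[|n]]] //; rewrite doubleS.
Qed.

Lemma common4_twins x y : #|common_nbrs e x y| = 4 -> e x =1 e y.
Proof.
move=> card4.
have eq_nbrs z : common_nbrs e x y \subset [set t | e z t] ->
    common_nbrs e x y = [set t | e z t].
  by move=> sub; apply/eqP; rewrite eqEcard sub card4; have := reg z; rewrite /degree => ->.
have subx : common_nbrs e x y \subset [set t | e x t].
  by apply/subsetP => z; rewrite !inE => /andP [].
have suby : common_nbrs e x y \subset [set t | e y t].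
  by apply/subsetP => z; rewrite !inE => /andP [].
move=> z; have := eq_nbrs y suby.
by rewrite (eq_nbrs x subx) => /setP/(_ z); rewrite !inE.
Qed.

(* The 4-cycle [p r q s], with [p, q] against [r, s], has a sign product of +1. *)
Definition positive (p q r s : T) : bool :=
  [&& p != q, r != s, e p r, e p s, e q r, e q s &
      (o p r == o q r) == (o p s == o q s)].

(** Exchanging the sides reverses four edges, and four sign changes cancel in the product. *)
Lemma positiveC p q r s : positive p q r s = positive r s p q.
Proof.
rewrite /positive !(symE r) !(symE s) andbCA; do 2! congr (_ && _).
case pr : (e p r); case ps : (e p s); case qr : (e q r); case qs : (e q s) => //=.
by rewrite (anti pr) (anti ps) (anti qr) (anti qs); do 4!case: o.
Qed.

(* Orthogonality of the rows [r] and [s]: two equal contributions, from [p]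
   and [q], must be balanced by two opposite ones. *)
Lemma positive_step p q r s : positive p q r s -> exists p' q',
  [/\ uniq [:: p; q; p'; q'], e r =1 mem [:: p; q; p'; q'],
      e s =1 mem [:: p; q; p'; q'] & positive r s p' q'].
Proof.
move=> pos; have := pos; rewrite positiveC => /and5P [rs pq rp rq /and3P [sp sq sgn]].
pose A b := [set z | e r z && e s z && ((o r z == o s z) == b)].
have balA b : #|A b| = #|A (~~ b)|.
  have At : A true = [set z | e r z && e s z && (o r z == o s z)].
    by apply/setP => z; rewrite !inE eqb_id.
  have Af : A false = [set z | e r z && e s z && (o r z != o s z)].
    by apply/setP => z; rewrite !inE eqbF_neg.
  by have := balanced rs; rewrite -At -Af; case: b.
pose b := o r p == o s p.
have : 1 < #|A (~~ b)|.
  by rewrite -balA; apply/card_gt1P; exists p, q; rewrite !inE rp rq sp sq pq /= eqxx eq_sym.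
move=> /card_gt1P [p' [q' [+ + p'q']]]; rewrite !inE.
move=> /andP [/andP [rp' sp'] bp'] /andP [/andP [rq' sq'] bq'].
have neq_sgn z z' : (o r z == o s z) = b -> (o r z' == o s z') == ~~ b -> z != z'.
  by move=> <-; apply: contraTneq => ->; case: (o r z' == o s z').
have bq : (o r q == o s q) = b by rewrite -(eqP sgn).
have u : uniq [:: p; q; p'; q'] by rewrite /= !inE !negb_or pq p'q' !neq_sgn.
exists p', q'; split=> //; try by apply: nbrs_of4; rewrite //= ?rp ?rq ?sp ?sq ?rp' ?rq' ?sp' ?sq'.
rewrite /positive rs p'q' rp' rq' sp' sq' /=.
by rewrite (eqP bp') (eqP bq').
Qed.

Definition next_pair (P Q R : T * T) : bool :=
  [&& uniq [:: P.1; P.2; R.1; R.2],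
      [forall z, e Q.1 z == (z \in [:: P.1; P.2; R.1; R.2])],
      [forall z, e Q.2 z == (z \in [:: P.1; P.2; R.1; R.2])] &
      positive Q.1 Q.2 R.1 R.2].

(** The iterated state holds two consecutive pairs. From a positive start [pick] always succeeds, by
    [positive_step], so the default of [odflt] is never taken. *)
Definition pair_chain (P0 P1 : T * T) (k : nat) : T * T :=
  (iter k (fun PQ => (PQ.2, odflt PQ.1 [pick R | next_pair PQ.1 PQ.2 R])) (P0, P1)).1.

Lemma pair_chainP p q r s : positive p q r s ->
  let P := pair_chain (p, q) (r, s) in
  forall k, next_pair (P k) (P k.+1) (P k.+2).
Proof.
move=> pos P k; rewrite /P /pair_chain /=.
set f := fun PQ : _ * _ => _.
suff [posk] : (let PQ := iter k f (p, q, (r, s)) in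
    positive PQ.1.1 PQ.1.2 PQ.2.1 PQ.2.2).
  case: pickP => //=; have [p' [q' [u e1 e2 pos']]] := positive_step posk.
  move=> /(_ (p', q')) /=; rewrite /next_pair u pos' /= andbT.
  by move=> /negbT/negP []; apply/andP; split; apply/forallP => z; apply/eqP.
elim: k => //= k posk; case: pickP => [R /and4P []//|].
have [p' [q' [u e1 e2 pos']]] := positive_step posk.
move=> /(_ (p', q')) /=; rewrite /next_pair u pos' /= andbT.
by move=> /negbT/negP []; apply/andP; split; apply/forallP => z; apply/eqP.
Qed.

(** Pigeonhole: among three common neighbours, two give the same answer to whether the signs from
    [x] and [y] agree. *)
Lemma twin_positive x y : x != y -> e x =1 e y -> exists r s, positive x y r s.
Proof.
move=> xy exy; have [a [b [c [d [u xN]]]]] := nbrs_of0 reg x.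
have := u; rewrite /= !inE !negb_or => /and4P [/and3P [ab ac ad] /andP [bc bd] cd _].
have [xa xb xc] : [/\ e x a, e x b & e x c] by rewrite !xN /= !inE !eqxx !orbT.
have [ya yb yc] : [/\ e y a, e y b & e y c] by rewrite -!exy.
have : [|| (o x a == o y a) == (o x b == o y b), (o x a == o y a) == (o x c == o y c)
         | (o x b == o y b) == (o x c == o y c)] by do 6!case: o.
by case/or3P => h; [exists a, b | exists a, c | exists b, c]; apply/and5P;
  split=> //; apply/and3P.
Qed.

End Balanced.

(** * Closing up the sequence of pairs *)

Section Chain.
Variables (T : finType) (e : rel T) (L : nat -> seq T).
Hypotheses (symE : symmetric e) (irrE : irreflexive e) (conn : connected e).
Hypotheses (size_L : forall k, size (L k) = 2) (uniq_L : forall k, uniq (L k ++ L k.+2)).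
Hypothesis nbr_L : forall k y, y \in L k.+1 -> e y =1 mem (L k ++ L k.+2).
Hypothesis twin_L0 : {in L 0 &, forall y z, e y =1 e z}.
Hypothesis reg : regular 4 e.

Let meet i j := has (mem (L i)) (L j).

Lemma chain_adj k y z : y \in L k -> z \in L k.+1 -> e y z.
Proof. by move=> yk zk; rewrite symE (nbr_L zk) /= mem_cat yk. Qed.

Lemma chain_uniq k : uniq (L k).
Proof. by have := uniq_L k; rewrite cat_uniq => /andP []. Qed.

Lemma chain_mem k : exists y, y \in L k.
Proof. by case: (L k) (size_L k) => // y l _; exists y; rewrite mem_head. Qed.

(** One vertex taken from each of [#|T|.+1] pairs must repeat. *)
Lemma chain_meets : exists m, [exists i : 'I_m, meet i m].
Proof.
have [x0 _] := chain_mem 0.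
pose f (k : 'I_#|T|.+1) := head x0 (L k).
have fL k : f k \in L k.
  by rewrite /f; case: (L k) (size_L k) => // y l _; apply: mem_head.
have /injectivePn [i [j ij fij]] : ~~ injectiveb f.
  apply/negP => /injectiveP /leq_card; rewrite card_ord ltnn //.
wlog lt_ij : i j ij fij / i < j.
  move=> H; move: (ij); rewrite -val_eqE neq_ltn => /orP [|] lt; first exact: (H i j).
  by apply: (H j i) => //; rewrite eq_sym.
exists j; apply/existsP; exists (Ordinal lt_ij); apply/hasP; exists (f j) => //=.
by rewrite -fij; apply: fL.
Qed.

Section FirstReturn.
Variable m : nat.
(** The pairs before index [m] are pairwise disjoint. *)
Hypothesis first : forall k i y, k < m -> i < k -> y \in L i -> y \in L k -> False.

(** Let [x] lie in [L m] and [L i]. If [i > 0], a vertex of [L m.-1], being adjacent to [x], lies in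
    [L i.-1] or [L i.+1], which contradicts disjointness. So [i = 0], and the twins in [L 0] have
    the same neighbours in [L m.-1], which puts both into [L m]. *)
Lemma chain_return : [exists i : 'I_m, meet i m] -> 3 <= m /\ L m =i L 0.
Proof.
case/existsP => -[i lt_im] /hasP [x xm /= xi].
have i2 : i.+2 <> m.
  move=> E; have := uniq_L i; rewrite E cat_uniq => /and3P [_ /hasPn/(_ x xm)/negP + _].
  by apply.
have i1 : i.+1 <> m by move=> E; rewrite -E in xm; have := chain_adj xi xm; rewrite irrE.
have m3 : 3 <= m by lia.
have [n En] : exists n, m = n.+3 by exists (m - 3); lia.
have [y yL] := chain_mem n.+2.
have exy : e x y by rewrite symE (chain_adj yL) // -En.
have i0 : i = 0.
  case: i lt_im xi i2 i1 => // i lt_im xi i2 i1; have := nbr_L xi y.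
  rewrite exy /= mem_cat => /esym /orP [] yi; exfalso.
    by apply: (@first n.+2 i y); rewrite ?En //; lia.
  by apply: (@first n.+2 i.+2 y); rewrite ?En //; lia.
rewrite {i lt_im i1 i2}i0 in xi; split=> //.
have sub : {subset L 0 <= L m}.
  move=> z z0; have ezy : e y z by rewrite symE (twin_L0 z0 xi).
  have := nbr_L yL z; rewrite ezy /= mem_cat => /esym /orP [] zL; last by rewrite En.
  by exfalso; apply: (@first n.+1 0 z); rewrite ?En.
have := uniq_min_size (chain_uniq 0) sub; rewrite !size_L leqnn => /(_ isT) [_ eqL].
by move=> z; rewrite eqL.
Qed.

Hypotheses (m3 : 3 <= m) (ret : L m =i L 0).

Lemma chain_memE k l z : k < m -> l < m -> z \in L l -> (z \in L k) = (k == l).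
Proof.
move=> km lm zl; apply/idP/eqP => [zk|-> //].
by case: (ltngtP k l) => // lt; exfalso; [apply: (@first l k z)|apply: (@first k l z)].
Qed.

Lemma chain_nbrs0 y : y \in L 0 -> e y =1 mem (L 1 ++ L m.-1).
Proof.
move=> yk; have [n En] : exists n, m = n.+3 by exists (m - 3); lia.
rewrite En /=; apply: (nbrs_of4 reg); rewrite ?size_cat ?size_L //.
  rewrite cat_uniq !chain_uniq /= andbT; apply/hasPn => t tn; apply/negP => t1.
  by apply: (@first n.+2 1 t); rewrite ?En.
apply/allP => t; rewrite mem_cat => /orP [t1|tn]; first exact: chain_adj t1.
by rewrite symE (chain_adj tn) // -En ret.
Qed.

Lemma chain_nbrs k y z l : k < m -> l < m -> y \in L k -> z \in L l ->
  e y z = cycle_adj m k l.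
Proof.
move=> km lm yk zl; case: k km yk => [|k] km yk.
- rewrite (chain_nbrs0 yk) /= mem_cat !(chain_memE _ lm zl) /cycle_adj; lia.
- rewrite (nbr_L yk) /= mem_cat (chain_memE _ lm zl); last lia.
  have [k2m|k2m] := ltnP k.+2 m.
    rewrite (chain_memE _ lm zl) // /cycle_adj; lia.
  have -> : k.+2 = m by lia.
  rewrite ret (chain_memE _ lm zl) /cycle_adj; lia.
Qed.

Lemma chain_isomorphic : isomorphic e (@doubled_cycle m).
Proof.
have [x0 _] := chain_mem 0.
pose g (kb : 'I_m * bool) := nth x0 (L kb.1) kb.2.
have gL kb : g kb \in L kb.1 by rewrite mem_nth // size_L; case: kb.2.
have g_inj : injective g.
  move=> [k b] [l c] gkl; have kl : k = l.
    apply/val_inj/eqP; rewrite /= -(@chain_memE k l (g (l, c))) //.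
    by rewrite -gkl; apply: gL.
  move: gkl; rewrite {}kl /g /= => /eqP; rewrite nth_uniq ?chain_uniq ?size_L;
    by [case: b; case: c | case: b | case: c].
(* The union of the first [m] pairs is closed under adjacency, so connectedness makes it
   everything. *)
have g_surj y : y \in codom g.
  apply: (connected_closed (x := g (Ordinal (leq_trans (isT : 0 < 3) m3), true)) conn).
    exact: codom_f.
  move=> _ /codomP [kb ->] z.
  have in_codom t l : l < m -> t \in L l -> t \in codom g.
    move=> lm tl; apply/codomP; exists (Ordinal lm, index t (L l) == 1).
    rewrite /g /=; have := nth_index x0 tl; have := index_mem t (L l).
    by rewrite tl size_L; case: (index _ _) => [|[|]].
  case: kb => -[k km] b; have := gL (Ordinal km, b) => /=.
  move: (g _) => t; case: k km => [|k] km tk etz.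
  - move: etz; rewrite (chain_nbrs0 tk) /= mem_cat => /orP [] zk.
      by apply: (in_codom _ 1) zk; lia.
    by apply: (in_codom _ m.-1) zk; lia.
  - move: etz; rewrite (nbr_L tk) /= mem_cat => /orP [] zk.
      by apply: (in_codom _ k) zk; lia.
    have [k2m|k2m] := ltnP k.+2 m; first exact: in_codom zk.
    have Em : k.+2 = m by lia.
    by apply: (in_codom _ 0); [lia | rewrite -ret -Em].
have g_bij : bijective g.
  apply: inj_card_bij => //; rewrite -(card_codom g_inj).
  exact/subset_leq_card/subsetP.
have [f fK gK] := g_bij; exists f; first by exists g.
by move=> y z; rewrite -{1}(gK y) -{1}(gK z) (@chain_nbrs (f y).1 _ _ (f z).1).
Qed.

End FirstReturn.

Lemma chain_doubled_cycle : exists m, 3 <= m /\ isomorphic e (@doubled_cycle m).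
Proof.
case: (ex_minnP chain_meets) => m meet_m min_m.
have first k i y : k < m -> i < k -> y \in L i -> y \in L k -> False.
  move=> km ik yi yk; suff : m <= k by lia.
  by apply: min_m; apply/existsP; exists (Ordinal ik); apply/hasP; exists y.
have [m3 ret] := chain_return first meet_m.
by exists m; split=> //; apply: chain_isomorphic.
Qed.

End Chain.

(** * Doubled cycles as [G2], [calG] and [calH] *)

Lemma isomorphic_trans (T1 T2 T3 : finType) (e1 : rel T1) (e2 : rel T2) (e3 : rel T3) :
  isomorphic e1 e2 -> isomorphic e2 e3 -> isomorphic e1 e3.
Proof.
move=> [f f_bij fe] [g g_bij ge]; exists (g \o f); first exact: bij_comp.
by move=> x y; rewrite fe ge.
Qed.

Lemma cycle_adjC m i j : cycle_adj m i j = cycle_adj m j i.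
Proof. rewrite /cycle_adj; lia. Qed.

(* Positions on the cycle: [u, v], then the pairs [U2 1 .. U2 t], then the
   pairs [V2 k] in decreasing order of [k]. *)
Definition cycle_pair (m t k : nat) : seq vname :=
  if k == 0 then [:: U0; V0] else if k <= t then U2 k else V2 (m - k).

(** Recovers the position from a name: [k.+1./2] is the index of the pair [U2] or [V2] that contains
    the [k]-th name. *)
Definition cycle_pos (m : nat) (x : vname) : nat :=
  match x with U k => k.+1./2 | V k => m - k.+1./2 | _ => 0 end.

Lemma mem_pair_list (p : nat -> vname) k x :
  reflect (x = p (2 * k - 1) \/ x = p (2 * k)) (x \in [:: p (2 * k - 1); p (2 * k)]).
Proof. by rewrite !inE; apply: (iffP orP) => -[] /eqP; [left | right | left | right]. Qed.

Lemma cycle_pairK m t k x : t < m -> k < m -> x \in cycle_pair m t k -> cycle_pos m x = k.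
Proof.
move=> tm km; rewrite /cycle_pair; case: eqP => [-> |k0].
  by rewrite !inE => /orP [] /eqP ->.
case: leqP => kt; [case/(mem_pair_list U)|case/(mem_pair_list V)] => -> /=; lia.
Qed.

Lemma size_cycle_pair m t k : size (cycle_pair m t k) = 2.
Proof. by rewrite /cycle_pair; case: eqP => //; case: leqP. Qed.

Lemma cycle_pair_uniq m t k : k < m -> uniq (cycle_pair m t k).
Proof.
move=> km; rewrite /cycle_pair; case: eqP => // k0.
by case: leqP => _; rewrite /= inE andbT; apply/eqP => -[]; lia.
Qed.

Lemma doubled_cycle_isomorphic m t vs es : t < m -> size vs <= 2 * m ->
  (forall k, k < m -> {subset cycle_pair m t k <= vs}) ->
  (forall x y, (x, y) \in es -> cycle_adj m (cycle_pos m x) (cycle_pos m y)) ->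
  (forall k l x y, k < m -> l < m -> x \in cycle_pair m t k -> y \in cycle_pair m t l ->
    l = k.+1 \/ k = 0 /\ l = m.-1 -> (x, y) \in es \/ (y, x) \in es) ->
  isomorphic (@doubled_cycle m) (list_graph (vs := vs) es).
Proof.
move=> tm size_vs pair_vs es_adj adj_es.
pose h (kb : 'I_m * bool) := nth U0 (cycle_pair m t kb.1) kb.2.
have hP kb : h kb \in cycle_pair m t kb.1.
  by rewrite mem_nth // size_cycle_pair; case: kb.2.
have hK kb : cycle_pos m (h kb) = kb.1 by apply: cycle_pairK (hP kb).
apply: (@isomorphic_list_graph _ _ h).
- move=> [k b] [l c] hkl; have kl : k = l.
    by apply/val_inj; rewrite /= -(hK (k, b)) hkl hK.
  move: hkl; rewrite {}kl /h /= => /eqP.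
  by rewrite nth_uniq ?cycle_pair_uniq ?size_cycle_pair; case: b; case: c.
- by move=> kb; apply: pair_vs (hP kb).
- by rewrite card_prod card_ord card_bool mulnC.
move=> x y; rewrite /doubled_cycle; apply/idP/orP; last first.
  by case=> /es_adj; rewrite !hK // cycle_adjC.
have edge (z w : 'I_m * bool) : w.1 = z.1.+1 :> nat \/ z.1 = 0 :> nat /\ w.1 = m.-1 :> nat ->
    (h z, h w) \in es \/ (h w, h z) \in es.
  by apply: adj_es (hP z) (hP w).
rewrite /cycle_adj => /or4P [/eqP xy|/eqP yx|/andP [/eqP x0 /eqP y0]|/andP [/eqP y0 /eqP x0]].
- by apply: edge; left.
- by apply/or_comm/edge; left.
- by apply: edge; right.
- by apply/or_comm/edge; right.
Qed.

Lemma mem_join A B x y : ((x, y) \in join A B) = (x \in A) && (y \in B).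
Proof.
apply/allpairsP/andP => [[[a b] [aA bB [-> ->]]] // | [xA yB]].
by exists (x, y).
Qed.

Lemma mem_joins (F G : nat -> seq vname) k0 n x y :
  reflect (exists k, [/\ k0 <= k < k0 + n, x \in F k & y \in G k])
    ((x, y) \in flatten [seq join (F k) (G k) | k <- iota k0 n]).
Proof.
apply: (iffP flattenP) => [[_ /mapP [k + ->]]|[k [kn xF yG]]].
  by rewrite mem_iota mem_join => kn /andP [xF yG]; exists k.
exists (join (F k) (G k)); last by rewrite mem_join xF.
by apply/mapP; exists k; rewrite ?mem_iota.
Qed.

Lemma in_U2 k x : x \in U2 k -> x = U (2 * k - 1) \/ x = U (2 * k).
Proof. by move/(mem_pair_list U). Qed.

Lemma in_V2 k x : x \in V2 k -> x = V (2 * k - 1) \/ x = V (2 * k).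
Proof. by move/(mem_pair_list V). Qed.

Lemma doubled_cycle3 : isomorphic (@doubled_cycle 3) G2.
Proof.
exists id; first by exists id.
move=> [[i i3] b] [[j j3] c]; rewrite /doubled_cycle /G2 /= -val_eqE /= /cycle_adj; lia.
Qed.

Lemma calG_edgesE i p : (p \in calG_edges i) =
  [|| p \in join [:: U0; V0] [:: U 1; U 2; V 1; V 2],
      p \in flatten [seq join (U2 k) (U2 k.+1) ++ join (V2 k) (V2 k.+1) | k <- iota 1 i] |
      p \in [:: (U (2 * i + 1), V (2 * i + 2)); (V (2 * i + 2), U (2 * i + 2));
                (U (2 * i + 2), V (2 * i + 1)); (V (2 * i + 1), U (2 * i + 1))]].
Proof. by rewrite [LHS]mem_cat [X in _ || X]mem_cat. Qed.

Lemma calH_edgesE j p : (p \in calH_edges j) =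
  [|| p \in join [:: U0; V0] [:: U 1; U 2; V 1; V 2],
      p \in flatten [seq join (U2 k) (U2 k.+1) | k <- iota 1 j],
      p \in flatten [seq join (V2 k) (V2 k.+1) | k <- iota 1 (j - 1)] |
      p \in join (V2 j) (U2 j.+1)].
Proof. by rewrite [LHS]mem_cat [X in _ || X]mem_cat [X in _ || (_ || X)]mem_cat. Qed.

(** The cycle runs through [u, v], then [U2 1] up to [U2 i.+1], then [V2 i.+1] down to [V2 1]. The
    four edges listed last in [calG_edges] join [U2 i.+1] completely to [V2 i.+1]. *)
Lemma doubled_cycle_odd i : 1 <= i -> isomorphic (@doubled_cycle (2 * i + 3)) (@calG i).
Proof.
move=> i1; set m := 2 * i + 3; apply: (@doubled_cycle_isomorphic _ i.+1); rewrite {}/m; first lia.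
- rewrite /calG_vertices /= !size_cat !size_map !size_iota; lia.
- move=> k km x; rewrite /cycle_pair /calG_vertices !inE !mem_cat.
  case: eqP => [_|k0]; first by rewrite !inE => /orP [] ->; rewrite ?orbT.
  case: leqP => ki; [move/in_U2 | move/in_V2] => xk; do 2 (apply/orP; right);
    apply/orP; [left | right]; case: xk => ->; apply: map_f; rewrite mem_iota; lia.
- move=> x y; rewrite calG_edgesE => /or3P [].
  + rewrite mem_join !inE => /andP [xA yB].
    have -> : cycle_pos (2 * i + 3) x = 0 by case/orP: xA => /eqP ->.
    by case/or4P: yB => /eqP -> /=; rewrite /cycle_adj; lia.
  + case/flattenP => _ /mapP [k + ->]; rewrite mem_iota mem_cat !mem_join => ki.
    by case/orP => /andP [] ; [move/in_U2 => xk /in_U2 yk | move/in_V2 => xk /in_V2 yk];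
      case: xk => ->; case: yk => -> /=; rewrite /cycle_adj; lia.
  + by rewrite !inE => /or4P [] /eqP [-> ->] /=; rewrite /cycle_adj; lia.
- move=> k l x y km lm; rewrite /cycle_pair => xk yl kl.
  have mem4 (a b c d : vname * vname) (s := [:: a; b; c; d]) :
      [/\ a \in s, b \in s, c \in s & d \in s].
    by rewrite !inE !eqxx !orbT.
  have start z j : x \in [:: U0; V0] -> z \in [:: U 1; U 2; V 1; V 2] -> (x, z) \in calG_edges j.
    by move=> xA zB; rewrite calG_edgesE mem_join xA zB.
  have step j p q : 0 < j <= i -> p \in join (U2 j) (U2 j.+1) ++ join (V2 j) (V2 j.+1) ->
      p = q -> q \in calG_edges i.
    move=> ji pj <-; rewrite calG_edgesE; apply/or3P/Or32/flattenP.
    by eexists; last exact: pj; apply: map_f; rewrite mem_iota; lia.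
  move: xk yl; case: kl => [El|[-> ->]] /=.
  + rewrite El in lm *; case: eqP => [-> xk|k0].
      rewrite /= => yl; left; apply: start => //.
      by move: yl; rewrite !inE => /orP [] ->; rewrite ?orbT.
    (* Ascending along the [U2], descending along the [V2] (edges listed in the opposite direction),
       or turning from one to the other. *)
    have [ki|ki|->] := ltngtP k i.+1.
    * move=> xk yl; left; apply: (step k) erefl; first lia.
      by rewrite mem_cat mem_join xk yl.
    * move=> xk yl; right; apply: (step (2 * i + 3 - k.+1)) erefl.
        lia.
      rewrite mem_cat !mem_join yl.
      have -> : (2 * i + 3 - k.+1).+1 = 2 * i + 3 - k by lia.
      by rewrite xk orbT.
    * move=> /in_U2 xk.
      have -> : 2 * i + 3 - i.+2 = i.+1 by lia.
      have Ei1 : 2 * i.+1 - 1 = 2 * i + 1 by lia.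
      have Ei2 : 2 * i.+1 = 2 * i + 2 by lia.
      move/in_V2; move: xk; rewrite Ei1 Ei2 => xk.
      by move=> yl; rewrite !calG_edgesE; case: xk => ->; case: yl => ->;
        [right | left | left | right]; apply/or3P/Or33;
        case: (mem4 (U (2 * i + 1), V (2 * i + 2)) (V (2 * i + 2), U (2 * i + 2))
          (U (2 * i + 2), V (2 * i + 1)) (V (2 * i + 1), U (2 * i + 1))).
  + have -> : ((2 * i + 3).-1 == 0) = false by lia.
    have -> : ((2 * i + 3).-1 <= i.+1) = false by lia.
    have -> : 2 * i + 3 - (2 * i + 3).-1 = 1 by lia.
    move=> xk yl; left; apply: start => //.
    by move: yl; rewrite !inE => /orP [] ->; rewrite ?orbT.
Qed.

(** As in the odd case, but the turn goes from [U2 j.+1] to [V2 j], so there is one pair fewer on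
    the descending side. *)
Lemma doubled_cycle_even j : 1 <= j -> isomorphic (@doubled_cycle (2 * j + 2)) (@calH j).
Proof.
move=> j1; apply: (@doubled_cycle_isomorphic _ j.+1); first lia.
- rewrite /calH_vertices /= !size_cat !size_map !size_iota; lia.
- move=> k km x; rewrite /cycle_pair /calH_vertices !inE !mem_cat.
  case: eqP => [_|k0]; first by rewrite !inE => /orP [] ->; rewrite ?orbT.
  case: leqP => ki; [move/in_U2 | move/in_V2] => xk; do 2 (apply/orP; right);
    apply/orP; [left | right]; case: xk => ->; apply: map_f; rewrite mem_iota; lia.
- move=> x y; rewrite calH_edgesE => /or4P [].
  + rewrite mem_join !inE => /andP [xA yB].
    have -> : cycle_pos (2 * j + 2) x = 0 by case/orP: xA => /eqP ->.
    by case/or4P: yB => /eqP -> /=; rewrite /cycle_adj; lia.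
  + case/mem_joins => k [kj /in_U2 xk /in_U2 yk].
    by case: xk => ->; case: yk => -> /=; rewrite /cycle_adj; lia.
  + case/mem_joins => k [kj /in_V2 xk /in_V2 yk].
    by case: xk => ->; case: yk => -> /=; rewrite /cycle_adj; lia.
  + rewrite mem_join => /andP [/in_V2 xk /in_U2 yk].
    by case: xk => ->; case: yk => -> /=; rewrite /cycle_adj; lia.
- move=> k l x y km lm; rewrite /cycle_pair => xk yl kl.
  have start z : x \in [:: U0; V0] -> z \in [:: U 1; U 2; V 1; V 2] -> (x, z) \in calH_edges j.
    by move=> xA zB; rewrite calH_edgesE mem_join xA zB.
  move: xk yl; case: kl => [El|[-> ->]] /=.
  + rewrite El in lm *; case: eqP => [-> xk|k0].
      rewrite /= => yl; left; apply: start => //.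
      by move: yl; rewrite !inE => /orP [] ->; rewrite ?orbT.
    have [ki|ki|Ek] := ltngtP k j.+1.
    * move=> xk yl; left; rewrite calH_edgesE; apply/or4P/Or42/mem_joins.
      by exists k; split=> //; lia.
    * move=> xk yl; right; rewrite calH_edgesE; apply/or4P/Or43/mem_joins.
      exists (2 * j + 2 - k.+1); split=> //; first lia.
      by have -> : (2 * j + 2 - k.+1).+1 = 2 * j + 2 - k by lia.
    * rewrite Ek; have -> : 2 * j + 2 - j.+2 = j by lia.
      move=> xk yl; right; rewrite calH_edgesE; apply/or4P/Or44.
      by rewrite mem_join yl xk.
  + have -> : ((2 * j + 2).-1 == 0) = false by lia.
    have -> : ((2 * j + 2).-1 <= j.+1) = false by lia.
    have -> : 2 * j + 2 - (2 * j + 2).-1 = 1 by lia.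
    move=> xk yl; left; apply: start => //.
    by move: yl; rewrite !inE => /orP [] ->; rewrite ?orbT.
Qed.

Lemma doubled_cycle_in_F m (T : finType) (e : rel T) :
  3 <= m -> isomorphic e (@doubled_cycle m) -> in_F e.
Proof.
move=> m3 iso_m; have [E3|m4] : m = 3 \/ 4 <= m by lia.
  by right; left; rewrite E3 in iso_m; apply: isomorphic_trans iso_m doubled_cycle3.
do 4 right; case odd_m : (odd m).
  have [i Ei] : exists i, m = 2 * i + 3 by exists ((m - 3)./2); lia.
  left; exists i; first lia.
  by rewrite Ei in iso_m; apply: isomorphic_trans iso_m (doubled_cycle_odd _); lia.
have [j Ej] : exists j, m = 2 * j + 2 by exists ((m - 2)./2); lia.
right; exists j; first lia.
by rewrite Ej in iso_m; apply: isomorphic_trans iso_m (doubled_cycle_even _); lia.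
Qed.

(** * Optimum skew energy *)

Section SkewEnergy.
Import Order.TTheory GRing.Theory Num.Theory.
Local Open Scope ring_scope.
Local Open Scope sesquilinear_scope.

Lemma char_poly_conj (R : comUnitRingType) n (P A : 'M[R]_n) :
  P \in unitmx -> char_poly (invmx P *m A *m P) = char_poly A.
Proof.
move=> uP; set Q := map_mx polyC P; set Q' := map_mx polyC (invmx P).
have QQ : Q' *m Q = 1%:M by rewrite -map_mxM mulVmx // map_mx1.
have eqM : char_poly_mx (invmx P *m A *m P) = Q' *m char_poly_mx A *m Q.
  rewrite /char_poly_mx !map_mxM mulmxBr mulmxBl -/Q -/Q'.
  by rewrite scalar_mxC -[_%:M *m _ *m _]mulmxA QQ mulmx1.
rewrite /char_poly eqM !det_mulmx mulrC mulrA -det_mulmx.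
by rewrite (mulmx1C QQ) det1 mul1r.
Qed.

(** By the spectral theorem [A] is similar to the diagonal matrix, so both lists are the roots of
    one characteristic polynomial. *)
Lemma eigenvalues_normal (C : numClosedFieldType) n (A : 'M[C]_n) :
  A \is normalmx ->
  perm_eq (eigenvalues A) [seq spectral_diag A 0 i | i <- enum 'I_n].
Proof.
move=> /orthomx_spectralP defA; apply: prod_XsubC_eq.
rewrite big_map big_enum /=.
have charE : char_poly A = \prod_(z <- eigenvalues A) ('X - z%:P).
  rewrite /eigenvalues; case: closed_field_poly_normal => r /= def_r.
  by rewrite {1}def_r (monicP (char_poly_monic A)) scale1r.
rewrite -charE.
rewrite {1}defA char_poly_conj ?spectral_unit // char_poly_trig.
  by apply: eq_bigr => i _; rewrite mxE eqxx.
exact/diag_mx_is_trig.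
Qed.

(* Equality case of Cauchy-Schwarz: the hypotheses say that the [`|d_i|] have
   the same first two moments as the constant [c]. *)
Lemma normal_energy_eq (C : numClosedFieldType) n (A : 'M[C]_n) (c : C) :
  A \is normalmx -> 0 <= c ->
  \sum_(z <- eigenvalues A) `|z| = n%:R * c ->
  \tr (A *m A ^t*) = n%:R * c ^+ 2 -> A *m A ^t* = (c ^+ 2)%:M.
Proof.
move=> nA c_ge0; rewrite (perm_big _ (eigenvalues_normal nA)) big_map big_enum.
set d := spectral_diag A => /= sum1.
have uP := spectral_unitarymx A; set P := spectralmx A in uP.
have defA : A = P ^t* *m diag_mx d *m P.
  by rewrite -invmx_unitary // {1}(orthomx_spectralP nA).
have defAA : A *m A ^t* = P ^t* *m diag_mx (\row_i (`|d 0 i| ^+ 2)) *m P.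
  rewrite {2}defA !trmx_mul !map_mxM trmxCK tr_diag_mx map_diag_mx {1}defA.
  rewrite !mulmxA mulmxtVK // -[_ *m diag_mx d *m _]mulmxA.
  congr (_ *m _ *m _); rewrite mul_diag_mx; apply/matrixP => i j.
  by rewrite !mxE; case: eqP => [->|_]; rewrite ?mulr0n ?mulr0 // !mulr1n normCK.
rewrite defAA mxtrace_mulC mulmxA (unitarymxP uP) mul1mx mxtrace_diag.
under eq_bigr do rewrite mxE.
move=> sum2.
(* Expanding the square with both moments gives [n c^2 - 2 n c^2 + n c^2]; the terms are squares of
   reals, so each vanishes. *)
have sq0 : \sum_i (`|d 0 i| - c) ^+ 2 = 0.
  transitivity (\sum_i `|d 0 i| ^+ 2 - (\sum_i `|d 0 i|) * (c *+ 2) + \sum_(i < n) c ^+ 2).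
    rewrite mulr_suml -sumrB -big_split; apply: eq_bigr => i _.
    by rewrite sqrrB mulrnAr.
  rewrite sum1 sumr_const card_ord.
  rewrite sum2; ring.
have dc i : `|d 0 i| = c.
  have /psumr_eq0P/(_ i isT)/eqP : \sum_i (`|d 0 i| - c) ^+ 2 = 0 := sq0.
  rewrite sqrf_eq0 subr_eq0 => h; apply/eqP/h => j _.
  rewrite -real_normK ?exprn_ge0 // rpredB ?normr_real //.
  exact: ger0_real.
have -> : diag_mx (\row_i (`|d 0 i| ^+ 2)) = (c ^+ 2)%:M :> 'M[C]_n.
  by apply/matrixP => i j; rewrite !mxE dc.
by rewrite mul_mx_scalar -scalemxAl -invmx_unitary // mulVmx ?scalemx1 ?unitarymx_unit.
Qed.

Lemma max_degree_regular d (T : finType) (e : rel T) :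
  (0 < #|T|)%N -> regular d e -> max_degree e = d.
Proof.
move=> /card_gt0P [x _] reg; apply/eqP; rewrite eqn_leq; apply/andP; split.
  by apply/bigmax_leqP => y _; rewrite reg.
by rewrite -{1}(reg x) leq_bigmax.
Qed.

Section SkewAdjacency.
Variables (C : numClosedFieldType) (n : nat) (G sigma : rel 'I_n).
Hypothesis orients : orientation G sigma.
Let S := skew_adjacency C sigma.

Lemma trmx_skew_adjacency : S^T = - S.
Proof.
apply/matrixP => i j; rewrite !mxE.
by case: (orients i j) => _; case: (sigma i j); case: (sigma j i); rewrite ?opprK ?oppr0.
Qed.

Lemma adj_skew_adjacency : S ^t* = - S.
Proof.
rewrite -trmx_skew_adjacency; apply/matrixP => i j; rewrite !mxE.
by case: sigma; [|case: sigma]; rewrite ?rmorphN ?rmorph1 ?rmorph0.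
Qed.

(** Summed over [k], an entry of [S S^T] becomes the number of common neighbours with agreeing signs
    minus the number with opposite signs. *)
Lemma skew_adjacencyM i j k :
  S i k * S j k =
    (G i k && G j k && (sigma i k == sigma j k))%:R
    - (G i k && G j k && (sigma i k != sigma j k))%:R.
Proof.
rewrite !mxE; have [-> +] := orients i k; have [-> +] := orients j k.
by do 4![case: sigma => //=] => _ _; ring.
Qed.

Hypotheses (d : nat) (reg : regular d G) (opt : optimum_skew_energy C G sigma).

(** [normal_energy_eq] applies with [c = sqrtC d]: [S] is normal because its adjoint is [- S], and
    each diagonal entry of [S S^T] is a degree, so the trace is [n d]. *)
Lemma optimum_gram : (0 < n)%N -> S *m S^T = d%:R%:M.
Proof.
move=> n_gt0; have skS := trmx_skew_adjacency; have adS := adj_skew_adjacency.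
have -> : S^T = S ^t* by rewrite adS skS.
rewrite -[d%:R]sqrtCK; apply: normal_energy_eq.
- by apply/normalmxP; rewrite adS mulNmx mulmxN.
- by rewrite sqrtC_ge0 ler0n.
- by rewrite [LHS]opt (max_degree_regular _ reg) ?card_ord.
have -> : n%:R * sqrtC d%:R ^+ 2 = \sum_(i < n) d%:R :> C.
  by rewrite sumr_const card_ord sqrtCK mulr_natl.
rewrite adS -skS /mxtrace; apply: eq_bigr => i _; rewrite mxE -(reg i) /degree -sum1_card.
rewrite natr_sum [RHS]big_mkcond; apply: eq_bigr => k _.
rewrite [S^T k i]mxE skew_adjacencyM eqxx /= andbF subr0 andbb andbT inE.
by case: G.
Qed.

Lemma optimum_even : (0 < d)%N -> ~~ odd n.
Proof.
move=> d_gt0; apply/negP => odd_n.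
have /(congr1 determinant) := optimum_gram (odd_gt0 odd_n).
rewrite det_scalar det_mulmx.
have detS0 : \det S = 0.
  have : \det S = - \det S.
    rewrite -[LHS]det_tr trmx_skew_adjacency -scaleN1r detZ.
    by rewrite -signr_odd odd_n expr1 mulN1r.
  move/eqP; rewrite -subr_eq0 opprK -mulr2n mulrn_eq0 /=.
  by move/eqP.
by rewrite detS0 mul0r => /esym/eqP; rewrite expf_eq0 pnatr_eq0 eqn0Ngt d_gt0 andbF.
Qed.

Lemma optimum_balanced i j : i != j ->
  #|[set k | G i k && G j k && (sigma i k == sigma j k)]|
    = #|[set k | G i k && G j k && (sigma i k != sigma j k)]|.
Proof.
move=> ij; have n_gt0 : (0 < n)%N by case: (n) i {ij} => [[]|].
have /matrixP/(_ i j) := optimum_gram n_gt0.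
rewrite !mxE (negPf ij) mulr0n.
under eq_bigr do rewrite [S^T _ _]mxE skew_adjacencyM.
rewrite sumrB => /eqP; rewrite subr_eq0 -!natr_sum eqr_nat => /eqP eq_sum.
by rewrite !cardsE -!sum1_card [LHS]big_mkcond [RHS]big_mkcond.
Qed.

End SkewAdjacency.

End SkewEnergy.

(** * Combining the cases with and without twins *)

Theorem theorem3p3 (C : numClosedFieldType) (n : nat) (G sigma : rel 'I_n)
    (G_simple : simple_graph G) (G_connected : connected G)
    (sigma_orients_G : orientation G sigma) (G_4regular : regular 4 G)
    (G_sigma_optimum : optimum_skew_energy C G sigma) :
  in_F G.
Proof.
have [symG irrG] := G_simple.
have balanced := optimum_balanced sigma_orients_G G_4regular G_sigma_optimum.
have anti x y : G x y -> sigma y x = ~~ sigma x y.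
  by have [-> +] := sigma_orients_G x y; case: (sigma x y); case: (sigma y x).
have [/existsP [[x y] /= /andP [xy /eqP card4]]|no_twins] :=
    boolP [exists xy : 'I_n * 'I_n, (xy.1 != xy.2) && (#|common_nbrs G xy.1 xy.2| == 4)].
  have twins := common4_twins G_4regular card4.
  have [r [s pos]] := twin_positive sigma G_4regular xy twins.
  have chainP := pair_chainP symG G_4regular anti balanced pos.
  set P := pair_chain G sigma (x, y) (r, s) in chainP.
  have [|||||m [m3 iso_m]] := @chain_doubled_cycle _ G
    (fun k => [:: (P k).1; (P k).2]) symG irrG G_connected.
  - by [].
  - by move=> k; have /and4P [] := chainP k.
  - move=> k z zk; have /and4P [_ /forallP e1 /forallP e2 _] := chainP k.
    by move: zk; rewrite !inE => /orP [] /eqP -> t; apply/eqP.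
  (* [chainP] describes neighbourhoods only from index 1 on; at index 0 the pair is [x, y], twins by
     choice. *)
  - have twin0 z : z \in [:: (P 0).1; (P 0).2] -> G z =1 G x.
      by rewrite !inE => /orP [] /eqP -> t; rewrite // -twins.
    by move=> z w /twin0 ez /twin0 ew t; rewrite ez ew.
  - exact: G_4regular.
  exact: doubled_cycle_in_F iso_m.
apply: no_twins_in_F => //.
  move=> x y xy; have := common_024 G_4regular balanced xy; rewrite !inE.
  have := existsPn no_twins (x, y); rewrite /= xy /= => /negPf ->.
  by rewrite orbF.
by rewrite card_ord; apply: (optimum_even sigma_orients_G G_4regular G_sigma_optimum).
Qed.
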